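(* Let $\ell\ge 3$ be an odd integer. Then the odd graph $O_\ell$ has no $1$-perfect code.
   Context: For an integer $\ell\ge 2$, the odd graph $O_\ell$ is the graph whose vertices are the $(\ell-1)$-element subsets of a fixed set of $2\ell-1$ elements, two vertices being adjacent if and only if the corresponding subsets are disjoint. A $1$-perfect code in a graph $G$ is a set $C$ of vertices such that every vertex of $G$ is at distance at most $1$ from exactly one vertex of $C$. *)

(* Defs.v *)
From mathcomp Require Import all_boot.

Set Implicit Arguments.
Unset Strict Implicit.
Unset Printing Implicit Defensive.

(* A simple graph is given by its adjacency relation on a finite type. *)

Section Graph.

Variables (T : finType) (e : rel T).

(* The graph distance from x to y is at most k iff some walk of length at
   most k joins them; size p is the number of edges of the walk x :: p. *)
Definition dist_le (k : nat) (x y : T) : Prop :=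
  exists p : seq T, [/\ path e x p, last x p = y & size p <= k].

Definition perfect_code1 (C : {set T}) : Prop :=
  forall x : T, exists! c : T, c \in C /\ dist_le 1 x c.

End Graph.

Definition odd_vertex (l : nat) : finType :=
  {A : {set 'I_(2 * l - 1)} | #|A| == l - 1}.

Definition odd_adj (l : nat) : rel (odd_vertex l) :=
  fun A B => [disjoint val A & val B].

Lemma odd_adj_sym (l : nat) : symmetric (@odd_adj l).
Proof. by move=> A B; rewrite /odd_adj disjoint_sym. Qed.

(* The bound excludes l = 1, where the empty set is disjoint from itself. *)
Lemma odd_adj_irrefl (l : nat) : 2 <= l -> irreflexive (@odd_adj l).
Proof.
move=> l_ge2 A; rewrite /odd_adj -setI_eq0 setIid -cards_eq0.
by rewrite (eqP (valP A)) subn_eq0 leqNgt l_ge2.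
Qed.

(* Main.v *)
Require Import Defs.
From mathcomp Require Import all_boot.

Set Implicit Arguments.
Unset Strict Implicit.
Unset Printing Implicit Defensive.

(** Let [C] be a 1-perfect code, [c] a codeword and [x] a point of [c], and put
    [T := val c :\ x].  For each of the [l] points [y] outside [c], the vertex
    [y |: T] has a common neighbour with [c], so it is not a codeword
    ([code_swap_notin]), and hence it is disjoint from exactly one codeword.
    Conversely, a codeword [d] disjoint from [T] must contain [x], since two
    codewords are never disjoint; thus [c] and [d] together cover [2 * l - 3]
    points and exactly two points lie outside both ([card_outside_code_pair]).
    Counting the pairs [(y, d)] with [d] disjoint from [y |: T] in both ways
    shows that [l] is twice the number of codewords disjoint from [T], so the
    existence of a 1-perfect code forces [l] to be even. *)

Section PerfectCode.

Variables (T : finType) (e : rel T) (C : {set T}).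
Hypotheses (e_sym : symmetric e) (perfC : perfect_code1 e C).

Lemma dist_le1P x y : dist_le e 1 x y <-> x = y \/ e x y.
Proof.
split=> [[[|z [|z' p]] [/= + + //]] | [<-|xy]].
- by move=> _ ->; left.
- by rewrite andbT => xz <-; right.
- by exists [::].
by exists [:: y]; rewrite /= andbT.
Qed.

Lemma code_unique v c d : c \in C -> d \in C ->
  v = c \/ e v c -> v = d \/ e v d -> c = d.
Proof.
move=> cC dC /dist_le1P vc /dist_le1P vd.
have [b [_ bP]] := perfC v.
by rewrite -(bP c) // (bP d).
Qed.

Lemma code_adj_eq c d : c \in C -> d \in C -> e c d -> c = d.
Proof.
move=> cC dC cd; apply: (code_unique (v := c)) => //; first by left.
by right.
Qed.

Lemma code_common_neighbour c d v : c \in C -> d \in C ->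
  e c v -> e d v -> c = d.
Proof.
by move=> cC dC cv dv; apply: (code_unique (v := v)) => //;
  right; rewrite e_sym.
Qed.

Lemma card_code_neighbours v : v \notin C -> #|[set d in C | e v d]| = 1.
Proof.
move=> vC; have [c [[cC /dist_le1P vc] _]] := perfC v.
have evc : e v c by case: vc => // vc; rewrite vc cC in vC.
suff -> : [set d in C | e v d] = [set c] by rewrite cards1.
apply/setP=> d; rewrite !inE; apply/andP/eqP => [[dC vd]|->] //.
by apply: (code_unique (v := v)) => //; right.
Qed.

End PerfectCode.

Lemma disjoint_setU1 (T : finType) (y : T) (A B : {set T}) :
  [disjoint y |: A & B] = (y \notin B) && [disjoint A & B].
Proof. by rewrite -!setI_eq0 setIUl setU_eq0 !setI_eq0 disjoints1. Qed.

Lemma odd_vertex_inhabited l : 0 < l -> exists v : odd_vertex l, true.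
Proof.
move=> l_gt0; have: 0 < #|[set A : {set 'I_(2 * l - 1)} | #|A| == l - 1]|.
  by rewrite card_draws card_ord bin_gt0 leq_sub2r // leq_pmull.
by case/card_gt0P=> A; rewrite inE => cA; exists (Sub A cA).
Qed.

Section OddGraph.

Variables (l : nat) (C : {set odd_vertex l}).
Hypotheses (l_ge2 : 2 <= l) (perfC : perfect_code1 (@odd_adj l) C).

Let adj_sym := @odd_adj_sym l.

Lemma card_vertex (v : odd_vertex l) : #|val v| = l - 1.
Proof. exact: eqP (valP v). Qed.

Lemma card_compl_vertex (v : odd_vertex l) : #|~: val v| = l.
Proof.
by apply/eqP; rewrite -(eqn_add2l #|val v|) cardsC card_ord card_vertex
  mul2n -addnn addnBAC // ltnW.
Qed.

(** The complement of [y |: val c] is a vertex adjacent to both [c] and [v]. *)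
Lemma code_swap_notin (c v : odd_vertex l) x y : c \in C ->
  x \in val c -> y \notin val c -> val v = y |: (val c :\ x) -> v \notin C.
Proof.
move=> cC xc yc vE; apply/negP=> vC.
have wP : #|~: (y |: val c)| == l - 1.
  have := card_compl_vertex c; rewrite (cardsD1 y) inE yc => cE.
  by rewrite setCU setIC -setDE -(addKn 1 #|_|) cE.
pose w : odd_vertex l := Sub (~: (y |: val c)) wP.
have cw : odd_adj c w.
  by rewrite /odd_adj /w SubK -subsets_disjoint subsetUr.
have vw : odd_adj v w.
  by rewrite /odd_adj /w SubK -subsets_disjoint vE setUS // subD1set.
have := code_common_neighbour adj_sym perfC cC vC cw vw.
by move=> cv; move: yc; rewrite cv vE setU11.
Qed.

Lemma card_swap_code_neighbours (c : odd_vertex l) x y : c \in C ->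
  x \in val c -> y \notin val c ->
  #|[set d in C | [disjoint y |: (val c :\ x) & val d]]| = 1.
Proof.
move=> cC xc yc.
have vP : #|y |: (val c :\ x)| == l - 1.
  rewrite cardsU1 !inE (negbTE yc) andbF; apply/eqP.
  by rewrite -[RHS](card_vertex c) [RHS](cardsD1 x) xc.
pose v : odd_vertex l := Sub (y |: (val c :\ x)) vP.
have vC : v \notin C by apply: (code_swap_notin cC xc yc); rewrite SubK.
by have := card_code_neighbours perfC vC; rewrite /odd_adj /v SubK.
Qed.

Lemma code_meets (c d : odd_vertex l) : c \in C -> d \in C ->
  ~~ [disjoint val c & val d].
Proof.
move=> cC dC; apply/negP=> cd.
have cdE := code_adj_eq perfC cC dC cd.
have := odd_adj_irrefl l_ge2 c.
by rewrite /odd_adj {2}cdE cd.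
Qed.

(** Since [d] meets [c] but not [val c :\ x], it contains [x]; so the union has
    [(l - 2) + (l - 1)] of the [2 * l - 1] points. *)
Lemma card_outside_code_pair (c d : odd_vertex l) x : c \in C -> d \in C ->
  x \in val c -> [disjoint val c :\ x & val d] -> #|~: (val c :|: val d)| = 2.
Proof.
move=> cC dC xc Td.
have xd : x \in val d.
  apply: contraR (code_meets cC dC) => xd.
  by rewrite -(setD1K xc) disjoint_setU1 xd.
have cdE : val c :|: val d = (val c :\ x) :|: val d.
  rewrite -{1}(setD1K xc) -setUA; apply/setUidPr.
  by rewrite sub1set inE xd orbT.
have cT : #|val c :\ x|.+1 = l - 1.
  by rewrite -[RHS](card_vertex c) [RHS](cardsD1 x) xc.
have := cardsC (val c :|: val d).
rewrite cdE card_ord cardsU (disjoint_setI0 Td) cards0 subn0 card_vertex.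
move: l_ge2 cT; move: #|_ :\ _| #|~: _| => t u.
case: (l) => [|[|m]] // _; rewrite !subn1 => -[->].
rewrite mul2n !doubleS /= -addnn => /eqP.
by rewrite addnS addSnnS -(addn3 (m + m)) eqn_add2l => /eqP[].
Qed.

Lemma perfect_code_even : ~~ odd l.
Proof.
have [v _] := odd_vertex_inhabited (ltnW l_ge2).
have [c [[cC _] _]] := perfC v.
have /card_gt0P[x xc] : 0 < #|val c| by rewrite card_vertex subn_gt0.
pose T := val c :\ x.
(* Count the pairs (y, d) with y outside c and d a codeword disjoint from
   y |: T: there is one for each y, and two for each d disjoint from T. *)
have lE : l = \sum_(d in C | [disjoint T & val d]) 2.
  rewrite -{1}(card_compl_vertex c) -sum1_card.
  transitivity (\sum_(y in ~: val c)
      \sum_(d in C | [disjoint y |: T & val d]) 1).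
    apply: eq_bigr => y; rewrite inE => yc.
    by rewrite sum1dep_card (card_swap_code_neighbours cC xc yc).
  rewrite (exchange_big_dep (fun d => (d \in C) && [disjoint T & val d])) /=.
    apply: eq_bigr => d /andP[dC Td].
    rewrite -[RHS](card_outside_code_pair cC dC xc Td) -sum1_card.
    apply: eq_bigl => y; rewrite !inE dC disjoint_setU1 negb_or.
    by rewrite Td andbT.
  by move=> y d _ /andP[-> /=]; apply: disjointWl; apply: subsetUr.
by rewrite lE sum_nat_const muln2 odd_double.
Qed.

End OddGraph.

Theorem mainTheorem2 (l : nat) (l_ge3 : 3 <= l) (l_odd : odd l) :
  ~ exists C : {set odd_vertex l}, perfect_code1 (@odd_adj l) C.
Proof.
by case=> C /(perfect_code_even (ltnW l_ge3)); rewrite l_odd.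
Qed.
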